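(* Any Riemann ZMC example in $\mathbb{L}^3$ foliated by circles contained in spacelike planes is symmetric about the plane containing the centers of the circles of the foliation.
   Context: $\mathbb{L}^3$ is $\mathbb{R}^3$ with the metric $\langle,\rangle=dx_1^2+dx_2^2-dx_3^2$. A plane is spacelike if the induced metric on it is Riemannian. The mean curvature $H$ is defined where the induced metric of a surface is non-degenerate; zero mean curvature (ZMC) means $H=0$. A circle is a non-degenerate planar curve of nonzero constant curvature. A Riemann ZMC example is a non-rotational surface with zero mean curvature foliated by pieces of circles contained in parallel planes. After a rigid motion (isometry of $\mathbb{L}^3$) the planes of the foliation are parallel to $x_3=0$ and the circles are Euclidean circles. The curve formed by the centers of the circles is contained in a plane, which is vertical (parallel to the $x_3$-axis). Symmetric about a plane means invariant under the reflection across that plane. *)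

(* Defs.v *)
From Stdlib Require Import Reals.
From Coquelicot Require Import Coquelicot.
Open Scope R_scope.

Definition L3 : Type := (R * R * R)%type.

Definition crd1 (x : L3) : R := fst (fst x).
Definition crd2 (x : L3) : R := snd (fst x).
Definition crd3 (x : L3) : R := snd x.

Definition inner (x y : L3) : R :=
  crd1 x * crd1 y + crd2 x * crd2 y - crd3 x * crd3 y.

(* Lorentzian cross product: [inner (lcross x y) z] is the determinant of
   (x, y, z), hence the minus sign in the last coordinate. *)
Definition lcross (x y : L3) : L3 :=
  (crd2 x * crd3 y - crd3 x * crd2 y,
   crd3 x * crd1 y - crd1 x * crd3 y,
   - (crd1 x * crd2 y - crd2 x * crd1 y)).

Definition Derive3 (f : R -> L3) (t : R) : L3 :=
  (Derive (fun s => crd1 (f s)) t,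
   Derive (fun s => crd2 (f s)) t,
   Derive (fun s => crd3 (f s)) t).

Section ParametrizedSurface.

Variable X : R -> R -> L3.

Definition d_u (Y : R -> R -> L3) (u v : R) : L3 := Derive3 (fun s => Y s v) u.
Definition d_v (Y : R -> R -> L3) (u v : R) : L3 := Derive3 (fun s => Y u s) v.

Definition ffE (u v : R) : R := inner (d_u X u v) (d_u X u v).
Definition ffF (u v : R) : R := inner (d_u X u v) (d_v X u v).
Definition ffG (u v : R) : R := inner (d_v X u v) (d_v X u v).

(* The induced metric is non-degenerate at (u, v) iff this is nonzero. *)
Definition metric_det (u v : R) : R := ffE u v * ffG u v - ffF u v ^ 2.

(* Unit normal; [inner nu nu] is -1 where the surface is spacelike and 1 where
   it is timelike. *)
Definition normal (u v : R) : L3 :=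
  scal (/ sqrt (Rabs (metric_det u v))) (lcross (d_u X u v) (d_v X u v)).

Definition sfL (u v : R) : R := inner (normal u v) (d_u (d_u X) u v).
Definition sfM (u v : R) : R := inner (normal u v) (d_v (d_u X) u v).
Definition sfN (u v : R) : R := inner (normal u v) (d_v (d_v X) u v).

Definition mean_curvature (u v : R) : R :=
  inner (normal u v) (normal u v) / 2 *
  ((sfL u v * ffG u v - 2 * sfM u v * ffF u v + sfN u v * ffE u v)
     / metric_det u v).

(* The metric may degenerate on part of the surface; the mean curvature has to
   vanish wherever it is defined. *)
Definition zero_mean_curvature (D : R * R -> Prop) : Prop :=
  forall u v, D (u, v) -> metric_det u v <> 0 -> mean_curvature u v = 0.

Definition surface_image (D : R * R -> Prop) (x : L3) : Prop :=
  exists u v, D (u, v) /\ x = X u v.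

End ParametrizedSurface.

Definition isometry (f : L3 -> L3) : Prop :=
  forall x y, inner (minus (f x) (f y)) (minus (f x) (f y))
              = inner (minus x y) (minus x y).

(* A nontrivial continuous one-parameter group of isometries of L^3 fixing
   pointwise the line through [p] with direction [d] (of any causal type). *)
Definition rotation_group (p d : L3) (phi : R -> L3 -> L3) : Prop :=
  (forall x, phi 0 x = x) /\
  (forall s t x, phi (s + t) x = phi s (phi t x)) /\
  (forall x, forall s, continuous (fun s => phi s x) s) /\
  (forall s, isometry (phi s)) /\
  (forall s k, phi s (plus p (scal k d)) = plus p (scal k d)) /\
  (exists s x, phi s x <> x).

(* Invariance is required for small parameters only, so that an open piece of a
   surface of revolution also counts as rotational. *)
Definition rotational (S : L3 -> Prop) : Prop :=
  exists (p d : L3) (phi : R -> L3 -> L3),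
    d <> zero /\ rotation_group p d phi /\
    forall x, S x -> locally 0 (fun s => S (phi s x)).

(* [e1], [e2] is an orthonormal basis of the spacelike direction shared by the
   planes of the foliation; [e3] is their unit timelike normal. *)
Definition lorentz_frame (e1 e2 e3 : L3) : Prop :=
  inner e1 e1 = 1 /\ inner e2 e2 = 1 /\ inner e3 e3 = -1 /\
  inner e1 e2 = 0 /\ inner e1 e3 = 0 /\ inner e2 e3 = 0.

(* The circle of center [c] and radius [r] in the plane c + span (e1, e2),
   parametrized by the angle. *)
Definition circle_param (e1 e2 c : L3) (r v : R) : L3 :=
  plus c (scal r (plus (scal (cos v) e1) (scal (sin v) e2))).

Definition circle (e1 e2 c : L3) (r : R) (x : L3) : Prop :=
  exists v, x = circle_param e1 e2 c r v.

Definition circle_surface (e1 e2 : L3) (c : R -> L3) (r : R -> R) (t v : R)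
  : L3 := circle_param e1 e2 (c t) (r t) v.

Definition is_interval (A : R -> Prop) : Prop :=
  forall x y z, A x -> A z -> x <= y <= z -> A y.

Definition heights (D : R * R -> Prop) (t : R) : Prop := exists v, D (t, v).

(* A parameter domain (height, angle) over a nonempty open interval of heights;
   over each height the angles form a nonempty open interval, so that every leaf
   is a piece of a circle (possibly the entire circle). *)
Definition arc_domain (D : R * R -> Prop) : Prop :=
  open D /\ (exists t, heights D t) /\ is_interval (heights D) /\
  forall t, is_interval (fun v => D (t, v)).

Definition C2_at (f : R -> R) (t : R) : Prop :=
  ex_derive f t /\ ex_derive (Derive f) t /\ continuous (Derive (Derive f)) t.

(* [inner (c t) e3 = - t] says that the leaf with parameter [t] lies in the
   plane at height [t], as [e3] has square -1. *)
Definition riemann_zmc (e1 e2 e3 : L3) (D : R * R -> Prop)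
  (c : R -> L3) (r : R -> R) : Prop :=
  lorentz_frame e1 e2 e3 /\
  arc_domain D /\
  (forall t, heights D t ->
     inner (c t) e3 = - t /\ 0 < r t /\
     C2_at (fun s => crd1 (c s)) t /\ C2_at (fun s => crd2 (c s)) t /\
     C2_at (fun s => crd3 (c s)) t /\ C2_at r t) /\
  zero_mean_curvature (circle_surface e1 e2 c r) D /\
  ~ rotational (surface_image (circle_surface e1 e2 c r) D).

(* The plane through [p] orthogonal to [m]. *)
Definition plane (p m : L3) (x : L3) : Prop := inner (minus x p) m = 0.

(* The plane is "vertical", i.e. parallel to [e3], and contains the centers.
   Verticality matters: the centers may lie on a straight line, which is then
   contained in many planes. Orthogonality of [m] to the timelike [e3] makes [m]
   spacelike, so the reflection across the plane is well defined. *)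
Definition center_plane (e3 : L3) (D : R * R -> Prop) (c : R -> L3)
  (p m : L3) : Prop :=
  m <> zero /\ inner m e3 = 0 /\ forall t, heights D t -> plane p m (c t).

Definition reflection (p m : L3) (x : L3) : L3 :=
  minus x (scal (2 * inner (minus x p) m / inner m m) m).

Definition symmetric_about (p m : L3) (S : L3 -> Prop) : Prop :=
  forall x, S x <-> S (reflection p m x).

(* The surface swept by the entire circles carrying the leaves. *)
Definition completed_surface (e1 e2 : L3) (D : R * R -> Prop)
  (c : R -> L3) (r : R -> R) (x : L3) : Prop :=
  exists t, heights D t /\ circle e1 e2 (c t) (r t) x.

(* Main.v *)
(** In coordinates along the frame let the center at height t be (a, b, t) and
    put p(v) = a' cos v + b' sin v + r'. The induced metric has determinant
    r^2 (p^2 - 1), and where it is non-degenerate the zero mean curvature equation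
    is an affine relation in cos v and sin v; on an arc this forces
    r a'' = 2 r' a' and r b'' = 2 r' b', that is, a' / r^2 and b' / r^2 have
    zero derivative. An entirely degenerate leaf has a' = b' = 0. Hence (a', b')
    keeps a constant direction, which is nonzero somewhere since otherwise the
    centers lie on a vertical line and the surface is rotational. The centers
    therefore lie in exactly one vertical plane, and the reflection across it
    maps every circle of the foliation to itself. *)

Require Import Defs.
From Stdlib Require Import Reals Lra Classical.
From Coquelicot Require Import Coquelicot.
Open Scope R_scope.

(** * Linear algebra in Lorentz space *)

Lemma L3_ext (x y : L3) :
  crd1 x = crd1 y -> crd2 x = crd2 y -> crd3 x = crd3 y -> x = y.
Proof.
  destruct x as [[x1 x2] x3], y as [[y1 y2] y3]; unfold crd1, crd2, crd3; simpl.
  intros -> -> ->; reflexivity.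
Qed.

Lemma crd1_plus (x y : L3) : crd1 (plus x y) = crd1 x + crd1 y.
Proof. reflexivity. Qed.
Lemma crd2_plus (x y : L3) : crd2 (plus x y) = crd2 x + crd2 y.
Proof. reflexivity. Qed.
Lemma crd3_plus (x y : L3) : crd3 (plus x y) = crd3 x + crd3 y.
Proof. reflexivity. Qed.
Lemma crd1_minus (x y : L3) : crd1 (minus x y) = crd1 x - crd1 y.
Proof. reflexivity. Qed.
Lemma crd2_minus (x y : L3) : crd2 (minus x y) = crd2 x - crd2 y.
Proof. reflexivity. Qed.
Lemma crd3_minus (x y : L3) : crd3 (minus x y) = crd3 x - crd3 y.
Proof. reflexivity. Qed.
Lemma crd1_scal (k : R) (x : L3) : crd1 (scal k x) = k * crd1 x.
Proof. reflexivity. Qed.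
Lemma crd2_scal (k : R) (x : L3) : crd2 (scal k x) = k * crd2 x.
Proof. reflexivity. Qed.
Lemma crd3_scal (k : R) (x : L3) : crd3 (scal k x) = k * crd3 x.
Proof. reflexivity. Qed.
Lemma crd1_zero : crd1 (zero : L3) = 0.
Proof. reflexivity. Qed.
Lemma crd2_zero : crd2 (zero : L3) = 0.
Proof. reflexivity. Qed.
Lemma crd3_zero : crd3 (zero : L3) = 0.
Proof. reflexivity. Qed.
Lemma crd1_pair (a b d : R) : crd1 (a, b, d) = a.
Proof. reflexivity. Qed.
Lemma crd2_pair (a b d : R) : crd2 (a, b, d) = b.
Proof. reflexivity. Qed.
Lemma crd3_pair (a b d : R) : crd3 (a, b, d) = d.
Proof. reflexivity. Qed.

Ltac crds :=
  repeat (rewrite ?crd1_plus, ?crd2_plus, ?crd3_plus,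
                  ?crd1_minus, ?crd2_minus, ?crd3_minus,
                  ?crd1_scal, ?crd2_scal, ?crd3_scal,
                  ?crd1_zero, ?crd2_zero, ?crd3_zero,
                  ?crd1_pair, ?crd2_pair, ?crd3_pair).

Lemma inner_sym (x y : L3) : inner x y = inner y x.
Proof. unfold inner; ring. Qed.
Lemma inner_plus_l (x y z : L3) : inner (plus x y) z = inner x z + inner y z.
Proof. unfold inner; crds; ring. Qed.
Lemma inner_plus_r (x y z : L3) : inner z (plus x y) = inner z x + inner z y.
Proof. unfold inner; crds; ring. Qed.
Lemma inner_minus_l (x y z : L3) : inner (minus x y) z = inner x z - inner y z.
Proof. unfold inner; crds; ring. Qed.
Lemma inner_minus_r (x y z : L3) : inner z (minus x y) = inner z x - inner z y.
Proof. unfold inner; crds; ring. Qed.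
Lemma inner_scal_l (k : R) (x y : L3) : inner (scal k x) y = k * inner x y.
Proof. unfold inner; crds; ring. Qed.
Lemma inner_scal_r (k : R) (x y : L3) : inner y (scal k x) = k * inner y x.
Proof. unfold inner; crds; ring. Qed.
Lemma inner_zero_l (x : L3) : inner zero x = 0.
Proof. unfold inner; crds; ring. Qed.

Ltac bilin :=
  repeat (rewrite ?inner_plus_l, ?inner_plus_r, ?inner_minus_l, ?inner_minus_r,
                  ?inner_scal_l, ?inner_scal_r, ?inner_zero_l).

(** Lagrange's identity, with the sign opposite to the Euclidean one: the normal direction of a
    surface has square minus the determinant of the induced metric. *)
Lemma lcross_sq (x y : L3) :
  inner (lcross x y) (lcross x y) = inner x y ^ 2 - inner x x * inner y y.
Proof. unfold inner, lcross; crds; ring. Qed.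

(** The squared determinant equals the Gram determinant up to the factor -1, the determinant of the
    Lorentz metric. *)
Lemma gram_det (x y z : L3) :
  inner (lcross x y) z ^ 2 =
  - (inner x x * (inner y y * inner z z - inner y z ^ 2)
     - inner x y * (inner x y * inner z z - inner y z * inner x z)
     + inner x z * (inner x y * inner y z - inner y y * inner x z)).
Proof. unfold inner, lcross; crds; ring. Qed.

(** Expansion of [w] in the basis dual to [x], [y], [z]; when their determinant is nonzero, it shows
    that the three inner products determine [w]. *)
Lemma cramer (x y z w : L3) :
  scal (inner (lcross x y) z) w =
  plus (plus (scal (inner w x) (lcross y z)) (scal (inner w y) (lcross z x)))
       (scal (inner w z) (lcross x y)).
Proof. apply L3_ext; unfold inner, lcross; crds; ring. Qed.

Lemma frame_det_neq_0 (e1 e2 e3 : L3) :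
  lorentz_frame e1 e2 e3 -> inner (lcross e1 e2) e3 <> 0.
Proof.
  intros (H11 & H22 & H33 & H12 & H13 & H23) H0.
  pose proof (gram_det e1 e2 e3) as Hg.
  rewrite H0, H11, H22, H33, H12, H13, H23 in Hg; lra.
Qed.

Lemma frame_ext (e1 e2 e3 : L3) (x y : L3) :
  lorentz_frame e1 e2 e3 ->
  inner x e1 = inner y e1 -> inner x e2 = inner y e2 ->
  inner x e3 = inner y e3 -> x = y.
Proof.
  intros Hf h1 h2 h3.
  pose proof (frame_det_neq_0 _ _ _ Hf) as Hd.
  pose proof (cramer e1 e2 e3 (minus x y)) as Hc.
  rewrite !inner_minus_l, h1, h2, h3, !Rminus_diag in Hc.
  apply L3_ext; apply Rminus_diag_uniq.
  - apply (f_equal crd1) in Hc; revert Hc; crds; intros Hc.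
    apply (Rmult_eq_reg_l _ _ _) with (2 := Hd); lra.
  - apply (f_equal crd2) in Hc; revert Hc; crds; intros Hc.
    apply (Rmult_eq_reg_l _ _ _) with (2 := Hd); lra.
  - apply (f_equal crd3) in Hc; revert Hc; crds; intros Hc.
    apply (Rmult_eq_reg_l _ _ _) with (2 := Hd); lra.
Qed.

(** The sign of the last coefficient compensates for [e3] having square -1. *)
Lemma frame_expand (e1 e2 e3 : L3) (x : L3) :
  lorentz_frame e1 e2 e3 ->
  x = plus (plus (scal (inner x e1) e1) (scal (inner x e2) e2))
           (scal (- inner x e3) e3).
Proof.
  intros Hf; apply (frame_ext e1 e2 e3); trivial;
    destruct Hf as (H11 & H22 & H33 & H12 & H13 & H23); bilin;
    rewrite ?(inner_sym e3 e1), ?(inner_sym e3 e2), ?(inner_sym e2 e1),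
      ?H11, ?H22, ?H33, ?H12, ?H13, ?H23; ring.
Qed.

(** * Surfaces foliated by circles *)

Definition radial (e1 e2 : L3) (v : R) : L3 :=
  plus (scal (cos v) e1) (scal (sin v) e2).

Definition tangential (e1 e2 : L3) (v : R) : L3 :=
  plus (scal (- sin v) e1) (scal (cos v) e2).

Lemma d_v_circle (e1 e2 : L3) (c : R -> L3) (r : R -> R) (u v : R) :
  d_v (circle_surface e1 e2 c r) u v = scal (r u) (tangential e1 e2 v).
Proof.
  apply L3_ext; unfold tangential; crds; apply is_derive_unique;
  [ change (is_derive (fun s => crd1 (c u) + r u * (cos s * crd1 e1 + sin s * crd1 e2)) v
     (r u * (- sin v * crd1 e1 + cos v * crd1 e2)))
  | change (is_derive (fun s => crd2 (c u) + r u * (cos s * crd2 e1 + sin s * crd2 e2)) v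
     (r u * (- sin v * crd2 e1 + cos v * crd2 e2)))
  | change (is_derive (fun s => crd3 (c u) + r u * (cos s * crd3 e1 + sin s * crd3 e2)) v
     (r u * (- sin v * crd3 e1 + cos v * crd3 e2))) ];
  auto_derive; trivial; ring.
Qed.

Lemma d_vv_circle (e1 e2 : L3) (c : R -> L3) (r : R -> R) (u v : R) :
  d_v (d_v (circle_surface e1 e2 c r)) u v = scal (- r u) (radial e1 e2 v).
Proof.
  assert (H : forall s, d_v (circle_surface e1 e2 c r) u s
                        = scal (r u) (tangential e1 e2 s))
    by (intros; apply d_v_circle).
  apply L3_ext; unfold radial; crds; apply is_derive_unique.
  - apply (is_derive_ext (fun s => r u * (- sin s * crd1 e1 + cos s * crd1 e2))).
    + intros s; rewrite H; reflexivity.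
    + auto_derive; trivial; ring.
  - apply (is_derive_ext (fun s => r u * (- sin s * crd2 e1 + cos s * crd2 e2))).
    + intros s; rewrite H; reflexivity.
    + auto_derive; trivial; ring.
  - apply (is_derive_ext (fun s => r u * (- sin s * crd3 e1 + cos s * crd3 e2))).
    + intros s; rewrite H; reflexivity.
    + auto_derive; trivial; ring.
Qed.

Definition ex_derive3 (f : R -> L3) (t : R) : Prop :=
  ex_derive (fun s => crd1 (f s)) t /\ ex_derive (fun s => crd2 (f s)) t /\
  ex_derive (fun s => crd3 (f s)) t.

Lemma is_derive_inner (f : R -> L3) (t : R) (k : L3) :
  ex_derive3 f t -> is_derive (fun s => inner (f s) k) t (inner (Derive3 f t) k).
Proof.
  intros (h1 & h2 & h3); unfold inner, Derive3; crds.
  apply Derive_correct in h1; apply Derive_correct in h2; apply Derive_correct in h3.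
  set (a1 := Derive _ t) in *; set (a2 := Derive _ t) in h2 |- *.
  set (a3 := Derive _ t) in h3 |- *.
  assert (H : is_derive (fun s => plus (plus (scal (crd1 k) (crd1 (f s)))
     (scal (crd2 k) (crd2 (f s)))) (scal (- crd3 k) (crd3 (f s)))) t
     (plus (plus (scal (crd1 k) a1) (scal (crd2 k) a2)) (scal (- crd3 k) a3))).
  { apply (is_derive_plus (K := R_AbsRing) (V := R_NormedModule));
      [apply (is_derive_plus (K := R_AbsRing) (V := R_NormedModule))|];
      apply is_derive_scal; assumption. }
  replace (a1 * crd1 k + a2 * crd2 k - a3 * crd3 k) with
    (plus (plus (scal (crd1 k) a1) (scal (crd2 k) a2)) (scal (- crd3 k) a3))
    by (unfold plus, scal; simpl; unfold mult; simpl; ring).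
  revert H; apply is_derive_ext; intros s.
  unfold plus, scal; simpl; unfold mult; simpl; ring.
Qed.

Lemma is_derive_plus_mult (f r : R -> R) (k u : R) :
  ex_derive f u -> ex_derive r u ->
  is_derive (fun s => f s + r s * k) u (Derive f u + Derive r u * k).
Proof.
  intros hf hr.
  apply (is_derive_plus (K := R_AbsRing) (V := R_NormedModule)).
  - now apply Derive_correct.
  - apply (is_derive_ext (fun s => k * r s)); [intros; apply Rmult_comm|].
    rewrite Rmult_comm; apply is_derive_scal; now apply Derive_correct.
Qed.

(** The form center plus multiple of a fixed direction is preserved by differentiation in the
    height, so one statement serves the first and the second derivative. *)
Lemma d_u_plus_scal (c : R -> L3) (r : R -> R) (w : R -> L3) (u v : R) :
  ex_derive3 c u -> ex_derive r u ->
  d_u (fun s x => plus (c s) (scal (r s) (w x))) u v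
  = plus (Derive3 c u) (scal (Derive r u) (w v)).
Proof.
  intros (h1 & h2 & h3) hr.
  apply L3_ext; crds; apply is_derive_unique, is_derive_plus_mult; assumption.
Qed.

Lemma d_u_circle (e1 e2 : L3) (c : R -> L3) (r : R -> R) (u v : R) :
  ex_derive3 c u -> ex_derive r u ->
  d_u (circle_surface e1 e2 c r) u v
  = plus (Derive3 c u) (scal (Derive r u) (radial e1 e2 v)).
Proof. exact (d_u_plus_scal c r (radial e1 e2) u v). Qed.

Lemma d_u_ext_loc (Y Z : R -> R -> L3) (u v : R) :
  locally u (fun s => Y s v = Z s v) -> d_u Y u v = d_u Z u v.
Proof.
  intros H; apply L3_ext; apply Derive_ext_loc; revert H; apply filter_imp;
    intros s ->; reflexivity.
Qed.

Lemma d_uu_circle (e1 e2 : L3) (c : R -> L3) (r : R -> R) (u v : R) :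
  locally u (fun s => ex_derive3 c s /\ ex_derive r s) ->
  ex_derive3 (Derive3 c) u -> ex_derive (Derive r) u ->
  d_u (d_u (circle_surface e1 e2 c r)) u v
  = plus (Derive3 (Derive3 c) u) (scal (Derive (Derive r) u) (radial e1 e2 v)).
Proof.
  intros Hl Hc Hr.
  rewrite <- (d_u_plus_scal (Derive3 c) (Derive r) (radial e1 e2)); trivial.
  apply d_u_ext_loc; revert Hl; apply filter_imp; intros s [h1 h2].
  now apply d_u_circle.
Qed.

(** At a fixed height the first derivative is itself a circle with center [Derive3 c u] and radius
    factor [Derive r u], so [d_v_circle] applies to it. *)
Lemma d_vu_circle (e1 e2 : L3) (c : R -> L3) (r : R -> R) (u v : R) :
  ex_derive3 c u -> ex_derive r u ->
  d_v (d_u (circle_surface e1 e2 c r)) u v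
  = scal (Derive r u) (tangential e1 e2 v).
Proof.
  intros Hc Hr.
  rewrite <- (d_v_circle e1 e2 (Derive3 c) (Derive r) u v).
  apply L3_ext; apply Derive_ext; intros s; rewrite d_u_circle; trivial.
Qed.

(** The normalization enters as the cube of one nonzero scalar: twice through the square of the
    normal and once through the second fundamental form. The square of the unnormalized normal is
    minus the metric determinant, so all these factors cancel. *)
Lemma mean_curvature_eq_0 (X : R -> R -> L3) (u v : R) :
  metric_det X u v <> 0 -> mean_curvature X u v = 0 ->
  inner (lcross (d_u X u v) (d_v X u v)) (d_u (d_u X) u v) * ffG X u v
  - 2 * inner (lcross (d_u X u v) (d_v X u v)) (d_v (d_u X) u v) * ffF X u v
  + inner (lcross (d_u X u v) (d_v X u v)) (d_v (d_v X) u v) * ffE X u v = 0.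
Proof.
  intros Hd H.
  assert (Hq : 0 < sqrt (Rabs (metric_det X u v)))
    by (apply sqrt_lt_R0, Rabs_pos_lt, Hd).
  assert (Hi : / sqrt (Rabs (metric_det X u v)) <> 0)
    by (apply Rinv_neq_0_compat; lra).
  assert (Hn : inner (lcross (d_u X u v) (d_v X u v))
                     (lcross (d_u X u v) (d_v X u v)) <> 0).
  { rewrite lcross_sq; intros H0; apply Hd.
    unfold metric_det, ffE, ffF, ffG; lra. }
  unfold mean_curvature, sfL, sfM, sfN, normal in H; revert H; bilin.
  set (k := / sqrt _) in *; set (n := lcross _ _) in *.
  intros H.
  apply (Rmult_eq_reg_l (k * k * k * inner n n / 2 * / metric_det X u v)).
  - rewrite Rmult_0_r, <- H; unfold Rdiv; ring.
  - assert (/ metric_det X u v <> 0) by (now apply Rinv_neq_0_compat).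
    unfold Rdiv; repeat apply Rmult_integral_contrapositive_currified; trivial; lra.
Qed.

(** * The zero mean curvature equation in frame coordinates *)

Lemma lcross_frame (e1 e2 e3 : L3) (x1 x2 x3 y1 y2 z1 z2 : R) :
  inner (lcross (plus (plus (scal x1 e1) (scal x2 e2)) (scal x3 e3))
                (plus (scal y1 e1) (scal y2 e2)))
        (plus (scal z1 e1) (scal z2 e2))
  = inner (lcross e1 e2) e3 * (x3 * (y1 * z2 - y2 * z1)).
Proof. unfold inner, lcross; crds; ring. Qed.

Lemma inner_combination (e1 e2 e3 : L3) (x1 x2 x3 y1 y2 y3 : R) :
  lorentz_frame e1 e2 e3 ->
  inner (plus (plus (scal x1 e1) (scal x2 e2)) (scal x3 e3))
        (plus (plus (scal y1 e1) (scal y2 e2)) (scal y3 e3))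
  = x1 * y1 + x2 * y2 - x3 * y3.
Proof.
  intros (H11 & H22 & H33 & H12 & H13 & H23); bilin.
  rewrite (inner_sym e3 e1), (inner_sym e3 e2), (inner_sym e2 e1),
    H11, H22, H33, H12, H13, H23; ring.
Qed.

Lemma circle_first_form (e1 e2 e3 : L3) (c : R -> L3) (r : R -> R) (t v : R) :
  lorentz_frame e1 e2 e3 ->
  ex_derive3 c t -> ex_derive r t -> inner (Derive3 c t) e3 = -1 ->
  let p1 := inner (Derive3 c t) e1 in
  let p2 := inner (Derive3 c t) e2 in
  let X := circle_surface e1 e2 c r in
  ffE X t v = p1 ^ 2 + p2 ^ 2 - 1 + Derive r t ^ 2
              + 2 * Derive r t * (p1 * cos v + p2 * sin v) /\
  ffF X t v = r t * (p2 * cos v - p1 * sin v) /\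
  ffG X t v = r t ^ 2.
Proof.
  intros Hf Hc Hr H3 p1 p2 X.
  assert (Hu : d_u X t v = plus (plus (scal (p1 + Derive r t * cos v) e1)
      (scal (p2 + Derive r t * sin v) e2)) (scal 1 e3)).
  { unfold X; rewrite d_u_circle by trivial.
    rewrite (frame_expand e1 e2 e3 (Derive3 c t) Hf), H3; fold p1 p2.
    apply L3_ext; unfold radial; crds; ring. }
  assert (Hv : d_v X t v = plus (plus (scal (- (r t * sin v)) e1)
      (scal (r t * cos v) e2)) (scal 0 e3)).
  { unfold X; rewrite d_v_circle.
    apply L3_ext; unfold tangential; crds; ring. }
  unfold ffE, ffF, ffG; rewrite Hu, Hv, !inner_combination by trivial.
  assert (Hcs : sin v ^ 2 = 1 - cos v ^ 2)
    by (generalize (sin2_cos2 v); unfold Rsqr; lra).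
  repeat split; ring_simplify; rewrite ?Hcs; ring.
Qed.

Lemma circle_metric_det (e1 e2 e3 : L3) (c : R -> L3) (r : R -> R) (t v : R) :
  lorentz_frame e1 e2 e3 ->
  ex_derive3 c t -> ex_derive r t -> inner (Derive3 c t) e3 = -1 ->
  metric_det (circle_surface e1 e2 c r) t v
  = r t ^ 2 * ((inner (Derive3 c t) e1 * cos v + inner (Derive3 c t) e2 * sin v
                + Derive r t) ^ 2 - 1).
Proof.
  intros Hf Hc Hr H3; unfold metric_det.
  destruct (circle_first_form e1 e2 e3 c r t v Hf Hc Hr H3) as (-> & -> & ->).
  assert (Hcs : sin v ^ 2 = 1 - cos v ^ 2)
    by (generalize (sin2_cos2 v); unfold Rsqr; lra).
  ring_simplify; rewrite ?Hcs; ring.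
Qed.

(** The mixed derivative is tangent to the leaf, so the middle term of the mean curvature drops out
    and the coefficient F is never expanded. The two other terms share the factor [r t ^ 2] times
    the frame determinant; dividing by it leaves an expression affine in [cos v] and [sin v]. *)
Lemma circle_zmc (e1 e2 e3 : L3) (c : R -> L3) (r : R -> R) (t v : R) :
  lorentz_frame e1 e2 e3 ->
  locally t (fun s => ex_derive3 c s /\ ex_derive r s) ->
  ex_derive3 (Derive3 c) t -> ex_derive (Derive r) t -> 0 < r t ->
  inner (Derive3 c t) e3 = -1 -> inner (Derive3 (Derive3 c) t) e3 = 0 ->
  let p1 := inner (Derive3 c t) e1 in
  let p2 := inner (Derive3 c t) e2 in
  let q1 := inner (Derive3 (Derive3 c) t) e1 in
  let q2 := inner (Derive3 (Derive3 c) t) e2 in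
  let X := circle_surface e1 e2 c r in
  metric_det X t v <> 0 -> mean_curvature X t v = 0 ->
  (p1 ^ 2 + p2 ^ 2 - 1 + Derive r t ^ 2 - r t * Derive (Derive r) t)
  + (2 * Derive r t * p1 - r t * q1) * cos v
  + (2 * Derive r t * p2 - r t * q2) * sin v = 0.
Proof.
  intros Hf Hl Hcc Hrr Hr0 H3 H33 p1 p2 q1 q2 X Hd Hm.
  destruct (locally_singleton _ _ Hl) as [Hc Hr].
  pose proof (mean_curvature_eq_0 X t v Hd Hm) as H.
  destruct (circle_first_form e1 e2 e3 c r t v Hf Hc Hr H3) as (HE & _ & HG).
  fold p1 p2 X in HE, HG.
  assert (Hu : d_u X t v = plus (plus (scal (p1 + Derive r t * cos v) e1)
      (scal (p2 + Derive r t * sin v) e2)) (scal 1 e3)).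
  { unfold X; rewrite d_u_circle by trivial.
    rewrite (frame_expand e1 e2 e3 (Derive3 c t) Hf), H3; fold p1 p2.
    apply L3_ext; unfold radial; crds; ring. }
  assert (Hv : d_v X t v = plus (scal (- (r t * sin v)) e1)
      (scal (r t * cos v) e2)).
  { unfold X; rewrite d_v_circle.
    apply L3_ext; unfold tangential; crds; ring. }
  assert (Huu : d_u (d_u X) t v
      = plus (scal (q1 + Derive (Derive r) t * cos v) e1)
             (scal (q2 + Derive (Derive r) t * sin v) e2)).
  { unfold X; rewrite d_uu_circle by trivial.
    rewrite (frame_expand e1 e2 e3 (Derive3 (Derive3 c) t) Hf), H33.
    fold q1 q2.
    apply L3_ext; unfold radial; crds; ring. }
  assert (Hvu : d_v (d_u X) t v = plus (scal (- (Derive r t * sin v)) e1)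
      (scal (Derive r t * cos v) e2)).
  { unfold X; rewrite d_vu_circle by trivial.
    apply L3_ext; unfold tangential; crds; ring. }
  assert (Hvv : d_v (d_v X) t v = plus (scal (- (r t * cos v)) e1)
      (scal (- (r t * sin v)) e2)).
  { unfold X; rewrite d_vv_circle.
    apply L3_ext; unfold radial; crds; ring. }
  rewrite Hu, Hv, Huu, Hvu, Hvv, !lcross_frame, HE, HG in H.
  apply (Rmult_eq_reg_l (inner (lcross e1 e2) e3 * r t ^ 2)).
  2: { apply Rmult_integral_contrapositive_currified;
         [now apply (frame_det_neq_0 e1 e2 e3) | apply pow_nonzero; lra]. }
  assert (Hcs : sin v ^ 2 = 1 - cos v ^ 2)
    by (generalize (sin2_cos2 v); unfold Rsqr; lra).
  rewrite Rmult_0_r, <- H.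
  ring_simplify.
  replace (sin v ^ 3) with (sin v * sin v ^ 2) by ring.
  rewrite Hcs; ring.
Qed.

(** * The curve of centers *)

(** The first and second derivatives vanish at [v] as well; they form a linear system in [b] and [d]
    whose determinant is, up to sign, [sin v ^ 2 + cos v ^ 2 = 1]. *)
Lemma trig_affine_zero (a b d v : R) :
  locally v (fun x => a + b * cos x + d * sin x = 0) -> b = 0 /\ d = 0.
Proof.
  intros H.
  assert (H1 : forall x, is_derive (fun y => a + b * cos y + d * sin y) x
                           (- b * sin x + d * cos x))
    by (intros x; auto_derive; trivial; ring).
  assert (H2 : locally v (fun x => - b * sin x + d * cos x = 0)).
  { apply locally_locally in H; revert H; apply filter_imp; intros x Hx.
    rewrite <- (is_derive_unique _ _ _ (H1 x)).
    rewrite (Derive_ext_loc _ (fun _ => 0)); [apply Derive_const | exact Hx]. }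
  assert (H3 : - b * cos v - d * sin v = 0).
  { rewrite <- (Derive_const 0 v).
    rewrite <- (Derive_ext_loc (fun x => - b * sin x + d * cos x) (fun _ => 0))
      by exact H2.
    symmetry; apply is_derive_unique; auto_derive; trivial; ring. }
  apply locally_singleton in H2.
  pose proof (sin2_cos2 v) as Hcs; unfold Rsqr in Hcs.
  split.
  - replace b with (b * (sin v * sin v + cos v * cos v)) by (rewrite Hcs; ring).
    replace (b * (sin v * sin v + cos v * cos v)) with
      (- sin v * (- b * sin v + d * cos v) - cos v * (- b * cos v - d * sin v))
      by ring.
    rewrite H2, H3; ring.
  - replace d with (d * (sin v * sin v + cos v * cos v)) by (rewrite Hcs; ring).
    replace (d * (sin v * sin v + cos v * cos v)) with
      (cos v * (- b * sin v + d * cos v) - sin v * (- b * cos v - d * sin v))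
      by ring.
    rewrite H2, H3; ring.
Qed.

(** By continuity the function cannot jump between 1 and -1, so near [v] it keeps its value [k] and
    [trig_affine_zero] applies. *)
Lemma trig_affine_sq_one (a b d v : R) :
  locally v (fun x => (b * cos x + d * sin x + a) ^ 2 = 1) -> b = 0 /\ d = 0.
Proof.
  intros H.
  set (k := b * cos v + d * sin v + a).
  assert (Hk : k ^ 2 = 1) by exact (locally_singleton _ _ H).
  assert (Hc : locally v (fun x => 0 < k * (b * cos x + d * sin x + a))).
  { assert (Hco : continuous (fun x => k * (b * cos x + d * sin x + a)) v).
    { apply (ex_derive_continuous (K := R_AbsRing) (V := R_NormedModule)).
      auto_derive; trivial. }
    apply (Hco (fun y => 0 < y)).
    apply (open_gt 0); fold k; nra. }
  apply (trig_affine_zero (a - k) b d v).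
  generalize (filter_and _ _ H Hc); apply filter_imp; intros x [h1 h2].
  destruct (Req_dec (b * cos x + d * sin x + a) k) as [e|n]; [lra|].
  assert (b * cos x + d * sin x + a = - k); [|nra].
  apply (Rmult_eq_reg_l (b * cos x + d * sin x + a - k)); [|lra].
  nra.
Qed.

Lemma open_section_l (D : R * R -> Prop) (t v : R) :
  open D -> D (t, v) -> locally t (fun s => D (s, v)).
Proof.
  intros HD Hd; destruct (HD _ Hd) as [eps He]; exists eps; intros s Hs.
  apply He; split; [exact Hs | apply ball_center].
Qed.

Lemma open_section_r (D : R * R -> Prop) (t v : R) :
  open D -> D (t, v) -> locally v (fun w => D (t, w)).
Proof.
  intros HD Hd; destruct (HD _ Hd) as [eps He]; exists eps; intros s Hs.
  apply He; split; [apply ball_center | exact Hs].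
Qed.

Lemma heights_open (D : R * R -> Prop) (t : R) :
  open D -> heights D t -> locally t (heights D).
Proof.
  intros HD [v Hv]; generalize (open_section_l D t v HD Hv).
  apply filter_imp; intros s Hs; now exists v.
Qed.

(** The two inner products come from differentiating [inner (c t) e3 = - t] twice, which is possible
    because the heights form an open set. *)
Lemma riemann_centers (e1 e2 e3 : L3) (D : R * R -> Prop) (c : R -> L3)
  (r : R -> R) (t : R) :
  riemann_zmc e1 e2 e3 D c r -> heights D t ->
  ex_derive3 c t /\ ex_derive3 (Derive3 c) t /\
  ex_derive r t /\ ex_derive (Derive r) t /\ 0 < r t /\
  inner (Derive3 c t) e3 = -1 /\ inner (Derive3 (Derive3 c) t) e3 = 0.
Proof.
  intros (_ & (HD & _) & Hreg & _ & _).
  assert (Hc : forall s, heights D s -> ex_derive3 c s /\ ex_derive3 (Derive3 c) s).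
  { intros s Hs.
    destruct (Hreg s Hs) as (_ & _ & (h1 & k1 & _) & (h2 & k2 & _) &
                             (h3 & k3 & _) & _).
    now repeat split. }
  assert (H1 : forall s, heights D s -> inner (Derive3 c s) e3 = -1).
  { intros s Hs.
    rewrite <- (is_derive_unique _ _ _ (is_derive_inner c s e3 (proj1 (Hc s Hs)))).
    rewrite (Derive_ext_loc _ (fun x => - x)).
    - apply is_derive_unique; auto_derive; trivial; ring.
    - generalize (heights_open D s HD Hs); apply filter_imp; intros x Hx.
      apply (Hreg x Hx). }
  intros Ht; destruct (Hc t Ht) as [Hc1 Hc2].
  destruct (Hreg t Ht) as (_ & Hr0 & _ & _ & _ & (Hr & Hrr & _)).
  do 6 (split; [now auto|]).
  rewrite <- (is_derive_unique _ _ _ (is_derive_inner (Derive3 c) t e3 Hc2)).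
  rewrite (Derive_ext_loc _ (fun _ => -1)); [apply Derive_const|].
  generalize (heights_open D t HD Ht); apply filter_imp; exact H1.
Qed.

Lemma riemann_leaf (e1 e2 e3 : L3) (D : R * R -> Prop) (c : R -> L3)
  (r : R -> R) (t : R) :
  riemann_zmc e1 e2 e3 D c r -> heights D t ->
  let p1 := inner (Derive3 c t) e1 in
  let p2 := inner (Derive3 c t) e2 in
  (p1 = 0 /\ p2 = 0) \/
  (r t * inner (Derive3 (Derive3 c) t) e1 = 2 * Derive r t * p1 /\
   r t * inner (Derive3 (Derive3 c) t) e2 = 2 * Derive r t * p2).
Proof.
  intros H Ht p1 p2.
  destruct (riemann_centers _ _ _ _ _ _ _ H Ht)
    as (Hc & Hcc & Hr & Hrr & Hr0 & H3 & H33).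
  pose proof H as (Hf & (HD & _) & _ & Hz & _).
  pose (h := fun v => p1 * cos v + p2 * sin v + Derive r t).
  (* By [circle_metric_det] the metric degenerates exactly where [h v ^ 2 = 1]. One non-degenerate
     point yields an arc of them, on which the affine trigonometric equation holds; otherwise
     [h ^ 2 = 1] on the whole leaf. *)
  destruct (classic (exists v, D (t, v) /\ h v ^ 2 <> 1)) as [[v [Hv Hn]]|Hn].
  - right.
    assert (Hloc : locally v (fun w => h w ^ 2 <> 1)).
    { assert (Hco : continuous (fun w => h w ^ 2) v).
      { apply (ex_derive_continuous (K := R_AbsRing) (V := R_NormedModule)).
        unfold h; auto_derive; trivial. }
      apply (Hco (fun y => y <> 1)); now apply (open_neq 1). }
    destruct (trig_affine_zero
      (p1 ^ 2 + p2 ^ 2 - 1 + Derive r t ^ 2 - r t * Derive (Derive r) t)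
      (2 * Derive r t * p1 - r t * inner (Derive3 (Derive3 c) t) e1)
      (2 * Derive r t * p2 - r t * inner (Derive3 (Derive3 c) t) e2) v)
      as [h1 h2]; [|lra].
    generalize (filter_and _ _ Hloc (open_section_r D t v HD Hv)).
    apply filter_imp; intros w [Hw HDw].
    assert (Hd : metric_det (circle_surface e1 e2 c r) t w <> 0).
    { rewrite (circle_metric_det e1 e2 e3) by trivial.
      apply Rmult_integral_contrapositive_currified;
        [apply pow_nonzero; lra | fold p1 p2; fold (h w); lra]. }
    apply (circle_zmc e1 e2 e3); trivial; [|now apply Hz].
    generalize (heights_open D t HD Ht); apply filter_imp; intros s Hs.
    now destruct (riemann_centers _ _ _ _ _ _ _ H Hs) as (? & _ & ? & _).
  - left; destruct Ht as [v Hv].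
    apply (trig_affine_sq_one (Derive r t) p1 p2 v).
    generalize (open_section_r D t v HD Hv); apply filter_imp; intros w Hw.
    apply NNPP; intros Hne; apply Hn; now exists w.
Qed.

(** * Constancy of the direction of the center curve *)

Lemma derive_zero_const (I : R -> Prop) (f : R -> R) (x y : R) :
  is_interval I -> (forall t, I t -> is_derive f t 0) -> I x -> I y -> f x = f y.
Proof.
  intros HI Hf.
  assert (Hlt : forall x y, I x -> I y -> x < y -> f x = f y).
  { intros a b Ha Hb Hab; apply (eq_is_derive f a b); trivial.
    intros t Ht; apply Hf; now apply (HI a t b). }
  intros Hx Hy; destruct (Rtotal_order x y) as [h|[->|h]]; trivial.
  - now apply Hlt.
  - symmetry; now apply Hlt.
Qed.

(* On a leaf lying in a null cone both quotients vanish, but their derivatives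
   are not controlled; on every other leaf both derivatives vanish. In either
   case all products of two of the quotients have zero derivative. *)
Lemma center_directions_parallel (e1 e2 e3 : L3) (D : R * R -> Prop)
  (c : R -> L3) (r : R -> R) (s t : R) :
  riemann_zmc e1 e2 e3 D c r -> heights D s -> heights D t ->
  inner (Derive3 c s) e1 * inner (Derive3 c t) e2
  = inner (Derive3 c s) e2 * inner (Derive3 c t) e1.
Proof.
  intros H Hs Ht.
  (* For [k] equal to [e1] or [e2], the numerator of the derivative [g'] is the difference of the
     two sides of an equation in [riemann_leaf]. *)
  pose (g := fun k x => inner (Derive3 c x) k / r x ^ 2).
  pose (g' := fun k x => (r x * inner (Derive3 (Derive3 c) x) k
                          - 2 * Derive r x * inner (Derive3 c x) k) / r x ^ 3).
  assert (Hg : forall k x, heights D x -> is_derive (g k) x (g' k x)).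
  { intros k x Hx.
    destruct (riemann_centers _ _ _ _ _ _ _ H Hx)
      as (_ & Hcc & Hr & _ & Hr0 & _ & _).
    pose proof (is_derive_inner (Derive3 c) x k Hcc) as Hi.
    unfold g, g'.
    replace ((r x * inner (Derive3 (Derive3 c) x) k
              - 2 * Derive r x * inner (Derive3 c x) k) / r x ^ 3)
      with ((inner (Derive3 (Derive3 c) x) k * r x ^ 2
             - inner (Derive3 c x) k * (INR 2 * Derive r x * r x ^ 1))
            / (r x ^ 2) ^ 2) by (simpl INR; field; lra).
    apply (is_derive_div (fun y => inner (Derive3 c y) k) (fun y => r y ^ 2));
      trivial.
    - apply is_derive_pow; now apply Derive_correct.
    - apply pow_nonzero; lra. }
  assert (Hz : forall x, heights D x ->
    (g e1 x = 0 /\ g e2 x = 0) \/ (g' e1 x = 0 /\ g' e2 x = 0)).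
  { intros x Hx; unfold g, g'.
    destruct (riemann_leaf _ _ _ _ _ _ _ H Hx) as [[h1 h2]|[h1 h2]];
      [left|right]; rewrite h1, h2; split; unfold Rdiv; ring. }
  assert (Hp : forall k l, (k = e1 \/ k = e2) -> (l = e1 \/ l = e2) ->
    g k s * g l s = g k t * g l t).
  { intros k l Hk Hl.
    apply (derive_zero_const (heights D) (fun x => g k x * g l x)); trivial.
    { apply H. }
    intros x Hx.
    replace 0 with (g' k x * g l x + g k x * g' l x).
    - apply (is_derive_mult (g k) (g l) x); auto using Rmult_comm.
    - destruct (Hz x Hx) as [[h1 h2]|[h1 h2]];
        destruct Hk as [-> | ->], Hl as [-> | ->]; rewrite ?h1, ?h2; ring. }
  assert (H11 := Hp e1 e1 (or_introl eq_refl) (or_introl eq_refl)).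
  assert (H12 := Hp e1 e2 (or_introl eq_refl) (or_intror eq_refl)).
  assert (H22 := Hp e2 e2 (or_intror eq_refl) (or_intror eq_refl)).
  (* Only products taken at one height are known to be constant, so the determinant is squared: its
     square is a polynomial in such products, and vanishes once those at [s] are replaced by those
     at [t]. *)
  assert (Hpar : g e1 s * g e2 t - g e2 s * g e1 t = 0).
  { apply Rsqr_0_uniq; unfold Rsqr.
    replace ((g e1 s * g e2 t - g e2 s * g e1 t) *
             (g e1 s * g e2 t - g e2 s * g e1 t))
      with (g e1 s * g e1 s * (g e2 t * g e2 t)
            - 2 * (g e1 s * g e2 s) * (g e1 t * g e2 t)
            + g e2 s * g e2 s * (g e1 t * g e1 t)) by ring.
    rewrite H11, H12, H22; ring. }
  destruct (riemann_centers _ _ _ _ _ _ _ H Hs) as (_ & _ & _ & _ & Hr1 & _).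
  destruct (riemann_centers _ _ _ _ _ _ _ H Ht) as (_ & _ & _ & _ & Hr2 & _).
  assert (E : forall k x, 0 < r x -> inner (Derive3 c x) k = g k x * r x ^ 2)
    by (intros k x Hx; unfold g; field; lra).
  rewrite (E e1 s), (E e2 s), (E e1 t), (E e2 t) by trivial.
  apply Rminus_diag_uniq.
  replace (_ - _) with ((g e1 s * g e2 t - g e2 s * g e1 t) * r s ^ 2 * r t ^ 2)
    by ring.
  rewrite Hpar; ring.
Qed.

(** * Vertical centers and rotations *)

Lemma L3_continuous (f : R -> L3) (s : R) :
  continuous (fun t => crd1 (f t)) s -> continuous (fun t => crd2 (f t)) s ->
  continuous (fun t => crd3 (f t)) s -> continuous f s.
Proof.
  intros h1 h2 h3; apply filterlim_locally; intros eps.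
  generalize (filter_and _ _ (filter_and _ _
    (proj1 (filterlim_locally _ _) h1 eps) (proj1 (filterlim_locally _ _) h2 eps))
    (proj1 (filterlim_locally _ _) h3 eps)).
  apply filter_imp; intros t [[b1 b2] b3]; now repeat split.
Qed.

(** The rotation by angle [s] about the axis through [p] orthogonal to [e1] and [e2], written as [x]
    plus a displacement (rotation matrix minus identity), so that the component along the axis never
    appears. *)
Definition frame_rotation (e1 e2 p : L3) (s : R) (x : L3) : L3 :=
  let y1 := inner (minus x p) e1 in
  let y2 := inner (minus x p) e2 in
  plus x (plus (scal ((cos s - 1) * y1 - sin s * y2) e1)
               (scal (sin s * y1 + (cos s - 1) * y2) e2)).

Lemma frame_rotation_group (e1 e2 e3 p : L3) :
  lorentz_frame e1 e2 e3 -> rotation_group p e3 (frame_rotation e1 e2 p).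
Proof.
  intros (H11 & H22 & H33 & H12 & H13 & H23).
  pose proof (eq_trans (inner_sym e2 e1) H12) as H21.
  pose proof (eq_trans (inner_sym e3 e1) H13) as H31.
  pose proof (eq_trans (inner_sym e3 e2) H23) as H32.
  unfold frame_rotation; repeat split.
  - intros x; rewrite cos_0, sin_0; apply L3_ext; crds; ring.
  - intros s t x; rewrite cos_plus, sin_plus.
    apply L3_ext; bilin; rewrite ?H11, ?H22, ?H12, ?H21; crds; ring.
  - intros x s; bilin.
    set (y1 := inner x e1 - inner p e1); set (y2 := inner x e2 - inner p e2).
    assert (Hk : forall a b d : R, continuous (fun s => a +
      (((cos s - 1) * y1 - sin s * y2) * b + (sin s * y1 + (cos s - 1) * y2) * d)) s).
    { intros a b d.
      apply (ex_derive_continuous (K := R_AbsRing) (V := R_NormedModule)).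
      auto_derive; trivial. }
    apply L3_continuous; apply Hk.
  - intros s x y.
    set (w := minus x y).
    (* The map is affine, so the difference of two images is the linear part applied to [w]. *)
    replace (minus _ _) with
      (plus w (plus (scal ((cos s - 1) * inner w e1 - sin s * inner w e2) e1)
               (scal (sin s * inner w e1 + (cos s - 1) * inner w e2) e2))).
    + bilin; rewrite (inner_sym e1 w), (inner_sym e2 w), H11, H22, H12, H21.
      assert (Hcs : sin s ^ 2 = 1 - cos s ^ 2)
        by (generalize (sin2_cos2 s); unfold Rsqr; lra).
      ring_simplify; rewrite ?Hcs; ring.
    + unfold w; apply L3_ext; bilin; crds; ring.
  - intros s k; bilin; rewrite H31, H32; apply L3_ext; crds; ring.
  (* The half turn sends [p + e1] to [p - e1], so the group is nontrivial. *)
  - exists PI, (plus p e1); rewrite cos_PI, sin_PI; intros He.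
    apply (f_equal (fun z => inner z e1)) in He; revert He; bilin.
    rewrite H11, H12, H21; lra.
Qed.

Lemma circle_rotation (e1 e2 e3 p z : L3) (k rho s v : R) :
  lorentz_frame e1 e2 e3 -> z = plus p (scal k e3) ->
  frame_rotation e1 e2 p s (circle_param e1 e2 z rho v)
  = circle_param e1 e2 z rho (v + s).
Proof.
  intros (H11 & H22 & H33 & H12 & H13 & H23) ->.
  unfold frame_rotation, circle_param; bilin.
  rewrite (inner_sym e3 e1), (inner_sym e3 e2), (inner_sym e2 e1),
    H11, H22, H12, H13, H23, cos_plus, sin_plus.
  apply L3_ext; crds; ring.
Qed.

(** Rotation about the line of centers shifts the angle along each leaf. As [D] is open, small
    shifts stay in the domain, even when the leaves are proper arcs. *)
Lemma vertical_centers_rotational (e1 e2 e3 : L3) (D : R * R -> Prop)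
  (c : R -> L3) (r : R -> R) (p : L3) :
  lorentz_frame e1 e2 e3 -> open D ->
  (forall t, heights D t -> exists k, c t = plus p (scal k e3)) ->
  rotational (surface_image (circle_surface e1 e2 c r) D).
Proof.
  intros Hf HD Hc.
  exists p, e3, (frame_rotation e1 e2 p); split; [|split].
  - intros H0; destruct Hf as (_ & _ & H33 & _).
    rewrite H0, inner_zero_l in H33; lra.
  - now apply (frame_rotation_group e1 e2 e3).
  - intros x (t & v & Hv & ->).
    destruct (Hc t (ex_intro _ v Hv)) as [k Hk].
    destruct (open_section_r D t v HD Hv) as [eps He].
    exists eps; intros s Hs; exists t, (v + s); split.
    + apply He; revert Hs.
      unfold ball; simpl; unfold AbsRing_ball, abs, minus, plus, opp; simpl.
      now replace (v + s + - v) with (s + - 0) by ring.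
    + now apply (circle_rotation e1 e2 e3 p (c t) k).
Qed.

Lemma derive_inner_const (I : R -> Prop) (c : R -> L3) (k : L3) (s t : R) :
  is_interval I -> (forall x, I x -> ex_derive3 c x) ->
  (forall x, I x -> inner (Derive3 c x) k = 0) -> I s -> I t ->
  inner (c s) k = inner (c t) k.
Proof.
  intros HI Hc Hk; apply (derive_zero_const I (fun x => inner (c x) k)); trivial.
  intros x Hx; rewrite <- (Hk x Hx); apply is_derive_inner; auto.
Qed.

(** Otherwise the components of the center along [e1] and [e2] are constant, the centers lie on a
    vertical line, and the surface is rotational. *)
Lemma riemann_slanted (e1 e2 e3 : L3) (D : R * R -> Prop) (c : R -> L3)
  (r : R -> R) :
  riemann_zmc e1 e2 e3 D c r ->
  exists t, heights D t /\
    inner (Derive3 c t) e1 ^ 2 + inner (Derive3 c t) e2 ^ 2 <> 0.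
Proof.
  intros H; pose proof H as (Hf & (HD & [t0 Ht0] & HI & _) & Hreg & _ & Hrot).
  apply NNPP; intros Hn; apply Hrot.
  assert (Hz : forall t, heights D t ->
    inner (Derive3 c t) e1 = 0 /\ inner (Derive3 c t) e2 = 0).
  { intros t Ht.
    assert (H0 : inner (Derive3 c t) e1 ^ 2 + inner (Derive3 c t) e2 ^ 2 = 0)
      by (apply NNPP; intros Hne; apply Hn; now exists t).
    split; nra. }
  assert (Hd : forall t, heights D t -> ex_derive3 c t)
    by (intros t Ht; apply (riemann_centers _ _ _ _ _ _ _ H Ht)).
  apply (vertical_centers_rotational e1 e2 e3 D c r (c t0)); trivial.
  intros t Ht; exists (t - t0).
  assert (h1 : inner (c t) e1 = inner (c t0) e1)
    by (apply (derive_inner_const (heights D)); trivial; apply Hz).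
  assert (h2 : inner (c t) e2 = inner (c t0) e2)
    by (apply (derive_inner_const (heights D)); trivial; apply Hz).
  pose proof (proj1 (Hreg t Ht)) as h3; pose proof (proj1 (Hreg t0 Ht0)) as h4.
  destruct (Hf) as (H11 & H22 & H33 & H12 & H13 & H23).
  apply (frame_ext e1 e2 e3); trivial; bilin;
    rewrite ?(inner_sym e3 e1), ?(inner_sym e3 e2), ?H13, ?H23, ?H33; lra.
Qed.

(** * Reflections *)

(** [acos x] has the right cosine and the right sine up to sign; negating the angle corrects the
    sign. *)
Lemma cos_sin_surjective (x y : R) :
  x ^ 2 + y ^ 2 = 1 -> exists v, cos v = x /\ sin v = y.
Proof.
  intros H.
  assert (Hx : -1 <= x <= 1) by nra.
  assert (Hs : sin (acos x) ^ 2 = y ^ 2).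
  { pose proof (sin2_cos2 (acos x)) as h; rewrite cos_acos in h by trivial.
    unfold Rsqr in h; lra. }
  destruct (Rsqr_eq (sin (acos x)) y) as [h|h]; [unfold Rsqr; lra| |].
  - exists (acos x); split; [now apply cos_acos | exact h].
  - exists (- acos x); rewrite cos_neg, sin_neg; split;
      [now apply cos_acos | lra].
Qed.

Lemma reflection_involutive (p m x : L3) :
  inner m m <> 0 -> reflection p m (reflection p m x) = x.
Proof.
  intros Hm; unfold reflection; bilin.
  apply L3_ext; crds; field; trivial.
Qed.

(** Since [m] is horizontal and the center lies on the mirror, the reflection fixes the center and
    acts on the radial unit vector as a planar reflection, whose image is again a unit vector and
    has some angle [w]. *)
Lemma circle_reflection (e1 e2 e3 p m z : L3) (rho : R) (x : L3) :
  lorentz_frame e1 e2 e3 -> inner m e3 = 0 -> inner m m <> 0 -> plane p m z ->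
  circle e1 e2 z rho x -> circle e1 e2 z rho (reflection p m x).
Proof.
  intros Hf Hm3 Hmm Hp [v ->].
  pose proof (frame_expand e1 e2 e3 m Hf) as Hm; rewrite Hm3 in Hm.
  set (m1 := inner m e1) in Hm; set (m2 := inner m e2) in Hm.
  assert (Hn : inner m m = m1 ^ 2 + m2 ^ 2).
  { rewrite Hm, inner_combination by trivial; ring. }
  rewrite Hn in Hmm.
  (* The coefficient of [m] that the planar reflection subtracts from the unit vector at angle
     [v]. *)
  set (k := 2 * (m1 * cos v + m2 * sin v) / (m1 ^ 2 + m2 ^ 2)).
  destruct (cos_sin_surjective (cos v - k * m1) (sin v - k * m2)) as [w [Hc Hs]].
  { assert (Hcs : sin v ^ 2 = 1 - cos v ^ 2)
      by (generalize (sin2_cos2 v); unfold Rsqr; lra).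
    replace ((cos v - k * m1) ^ 2 + (sin v - k * m2) ^ 2)
      with (cos v ^ 2 + sin v ^ 2) by (unfold k; field; trivial).
    rewrite Hcs; ring. }
  exists w; unfold plane in Hp; revert Hp; unfold reflection, circle_param.
  rewrite Hn, Hc, Hs; bilin; rewrite !(inner_sym _ m); fold m1 m2.
  intros Hp.
  replace (2 * _ / _) with (rho * k).
  - rewrite Hm; apply L3_ext; crds; ring.
  - replace (inner m z) with (inner m p) by lra; unfold k; field; trivial.
Qed.

Lemma completed_surface_symmetric (e1 e2 e3 : L3) (D : R * R -> Prop)
  (c : R -> L3) (r : R -> R) (p m : L3) :
  lorentz_frame e1 e2 e3 -> inner m m <> 0 -> center_plane e3 D c p m ->
  symmetric_about p m (completed_surface e1 e2 D c r).
Proof.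
  intros Hf Hmm (_ & Hm3 & Hp).
  assert (Hs : forall x, completed_surface e1 e2 D c r x ->
                completed_surface e1 e2 D c r (reflection p m x)).
  { intros x (t & Ht & Hx); exists t; split; trivial.
    apply (circle_reflection e1 e2 e3); auto. }
  (* The reflection is an involution, so invariance in one direction gives the other. *)
  intros x; split; [apply Hs|]; intros Hx.
  rewrite <- (reflection_involutive p m x Hmm); now apply Hs.
Qed.

Theorem corollary3p7 (e1 e2 e3 : L3) (D : R * R -> Prop)
  (c : R -> L3) (r : R -> R)
  (hS : riemann_zmc e1 e2 e3 D c r) :
  exists p m : L3,
    center_plane e3 D c p m /\
    (forall q k : L3, center_plane e3 D c q k ->
       forall x : L3, plane q k x <-> plane p m x) /\
    symmetric_about p m (completed_surface e1 e2 D c r) /\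
    ((forall t : R, heights D t -> forall x : L3,
        circle e1 e2 (c t) (r t) x ->
        surface_image (circle_surface e1 e2 c r) D x) ->
     symmetric_about p m (surface_image (circle_surface e1 e2 c r) D)).
Proof.
  pose proof hS as (Hf & (HD & _ & HI & _) & _).
  destruct (riemann_slanted _ _ _ _ _ _ hS) as (t0 & Ht0 & Hn).
  assert (Hd : forall t, heights D t -> ex_derive3 c t)
    by (intros t Ht; apply (riemann_centers _ _ _ _ _ _ _ hS Ht)).
  set (p1 := inner (Derive3 c t0) e1) in *.
  set (p2 := inner (Derive3 c t0) e2) in *.
  (* The horizontal velocity of the centers at [t0], turned by a right angle; it is nonzero by the
     choice of [t0]. The zero [e3] term puts [m] in the form required by [inner_combination]. *)
  pose (m := plus (plus (scal (- p2) e1) (scal p1 e2)) (scal 0 e3)).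
  assert (Hi : forall x, inner x m = p1 * inner x e2 - p2 * inner x e1)
    by (intros x; unfold m; bilin; ring).
  assert (Hmm : inner m m = p1 ^ 2 + p2 ^ 2)
    by (unfold m; rewrite inner_combination by trivial; ring).
  assert (Hcp : center_plane e3 D c (c t0) m).
  { split; [|split].
    - intros H0; apply Hn; rewrite <- Hmm, H0; apply inner_zero_l.
    - destruct Hf as (_ & _ & _ & _ & H13 & H23).
      rewrite inner_sym, Hi, !(inner_sym e3), H13, H23; ring.
    (* All horizontal velocities are parallel to the one at [t0], so [inner (c s) m] has zero
       derivative and is constant. *)
    - intros t Ht; unfold plane; bilin.
      rewrite (derive_inner_const (heights D) c m t t0); trivial; [ring|].
      intros s Hs; rewrite Hi.
      pose proof (center_directions_parallel _ _ _ _ _ _ t0 s hS Ht0 Hs) as Hpar.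
      fold p1 p2 in Hpar; lra. }
  exists (c t0), m; split; [exact Hcp|].
  assert (Hsym : symmetric_about (c t0) m (completed_surface e1 e2 D c r)).
  { apply (completed_surface_symmetric e1 e2 e3); trivial.
    now rewrite Hmm. }
  split; [|split; [exact Hsym|]].
  - intros q k (Hk0 & Hk3 & Hq).
    pose proof (frame_expand e1 e2 e3 k Hf) as Hk; rewrite Hk3 in Hk.
    set (k1 := inner k e1) in Hk; set (k2 := inner k e2) in Hk.
    assert (Ho : p1 * k1 + p2 * k2 = 0).
    (* On a plane containing the centers [inner (c t) k] is constant near [t0]; differentiating
       makes [k] orthogonal to the velocity there. *)
    { transitivity (inner (Derive3 c t0) k);
        [rewrite Hk; bilin; fold p1 p2; ring|].
      rewrite <- (is_derive_unique _ _ _ (is_derive_inner c t0 k (Hd t0 Ht0))).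
      rewrite (Derive_ext_loc _ (fun _ => inner q k)); [apply Derive_const|].
      generalize (heights_open D t0 HD Ht0); apply filter_imp; intros t Ht.
      generalize (Hq t Ht); unfold plane; bilin; lra. }
    (* In the horizontal plane the vectors orthogonal to [(p1, p2)] form the line of [(- p2, p1)],
       and [a] is the coordinate of [k] on it. The two planes thus have proportional normals and
       share the point [c t0]. *)
    set (a := (p1 * k2 - p2 * k1) / (p1 ^ 2 + p2 ^ 2)).
    assert (Ha : k = scal a m).
    { assert (h1 : k1 = - a * p2).
      { apply (Rmult_eq_reg_l (p1 ^ 2 + p2 ^ 2)); trivial.
        transitivity (p1 * (p1 * k1 + p2 * k2) - p2 * (p1 * k2 - p2 * k1)); [ring|].
        rewrite Ho; unfold a; field; trivial. }
      assert (h2 : k2 = a * p1).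
      { apply (Rmult_eq_reg_l (p1 ^ 2 + p2 ^ 2)); trivial.
        transitivity (p2 * (p1 * k1 + p2 * k2) + p1 * (p1 * k2 - p2 * k1)); [ring|].
        rewrite Ho; unfold a; field; trivial. }
      rewrite Hk, h1, h2; unfold m; apply L3_ext; crds; ring. }
    assert (Ha0 : a <> 0).
    { intros H0; apply Hk0; rewrite Ha, H0; apply L3_ext; crds; ring. }
    intros x; generalize (Hq t0 Ht0); unfold plane; rewrite Ha; bilin.
    intros Hq0; split; intros Hx.
    + apply (Rmult_eq_reg_l a); trivial; lra.
    + assert (h : inner x m = inner (c t0) m) by lra; rewrite h; lra.
  - intros Hfull x.
    (* When every leaf contributes its entire circle, the surface coincides with the completed one
       and inherits its symmetry. *)
    assert (He : forall y, surface_image (circle_surface e1 e2 c r) D y <->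
                           completed_surface e1 e2 D c r y).
    { intros y; split.
      - intros (t & v & Hv & ->); exists t; split; exists v; trivial.
      - intros (t & Ht & Hy); now apply (Hfull t). }
    rewrite !He; apply Hsym.
Qed.
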